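(* Let $x_1,x_2,x_3$ be three mutually orthonormal vectors in $\mathbb{R}^3$ and define the symmetric tensor $T\in S^3(\mathbb{R}^3)$ by $$T=\frac16\sum_{\sigma\in S^3}x_{\sigma(1)}\otimes x_{\sigma(2)}\otimes x_{\sigma(3)},$$ where the sum is over all permutations $\sigma$ of $\{1,2,3\}$. Then there is no optimal rank-$3$ completely orthogonal approximation of $T$ that is symmetric; that is, no minimizer of $\|T-Y\|$ over $Y\in\mathcal{CON}_3$ (over the base field $\mathbb{R}$) is a symmetric tensor.
   Context: Tensors in $\mathbb{R}^{n_1\times\cdots\times n_d}$ carry the inner product $\langle T,S\rangle=\sum_{i_1,\dots,i_d}T(i_1,\dots,i_d)S(i_1,\dots,i_d)$ and norm $\|T\|=\sqrt{\langle T,T\rangle}$. The tensor $v_1\otimes\cdots\otimes v_d$ has entries $\prod_j v_j(i_j)$. $S^d(\mathbb{R}^n)$ denotes the tensors in $\mathbb{R}^{n\times\cdots\times n}$ ($d$ factors) invariant under all permutations of the $d$ indices (symmetric tensors). Two tensors $x_1\otimes\cdots\otimes x_d$ and $y_1\otimes\cdots\otimes y_d$ are completely orthogonal if $\langle x_j,y_j\rangle=0$ for every $j=1,\dots,d$. $\mathcal{CON}_r$ is the set of all tensors of the form $\sum_{k=1}^r\sigma_k\,v_{k1}\otimes\cdots\otimes v_{kd}$ with scalars $\sigma_k\in\mathbb{R}$ (zero coefficients or zero vectors allowed, so that the rank is at most $r$) whose terms are pairwise completely orthogonal. An optimal rank-$r$ completely orthogonal approximation of $T$ is a minimizer of $\|T-Y\|$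 over $Y\in\mathcal{CON}_r$. *)

(* Defs.v *)
From mathcomp Require Import all_boot all_order all_fingroup all_algebra.
From mathcomp Require Import reals.

Set Implicit Arguments.
Unset Strict Implicit.
Unset Printing Implicit Defensive.

Import Order.TTheory GRing.Theory Num.Theory.
Local Open Scope ring_scope.

(* Tensors in R^(n x ... x n) with d factors, as functions of the multi-index.
   The codomain is R^o so that tensors form an lmodType over R. *)
Notation tensor R d n := {ffun {ffun 'I_d -> 'I_n} -> R^o}.

Definition tdot (R : realType) (d n : nat) (T S : tensor R d n) : R :=
  \sum_(i : {ffun 'I_d -> 'I_n}) T i * S i.

Definition tnorm (R : realType) (d n : nat) (T : tensor R d n) : R :=
  Num.sqrt (tdot T T).

Definition vdot (R : realType) (n : nat) (u v : 'rV[R]_n) : R :=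
  \sum_(i < n) u 0 i * v 0 i.

(* v_1 (x) ... (x) v_d *)
Definition tprod (R : realType) (d n : nat) (v : 'I_d -> 'rV[R]_n) :
    tensor R d n :=
  [ffun i : {ffun 'I_d -> 'I_n} => \prod_(j < d) v j 0 (i j)].

Definition symmetric_tensor (R : realType) (d n : nat) (T : tensor R d n)
    : Prop :=
  forall (s : 'S_d) (i : {ffun 'I_d -> 'I_n}), T [ffun j => i (s j)] = T i.

Definition completely_orthogonal (R : realType) (d n : nat)
    (x y : 'I_d -> 'rV[R]_n) : Prop :=
  forall j : 'I_d, vdot (x j) (y j) = 0.

(* The factors v k j may be zero and the coefficients may vanish, so members
   have rank at most r. Orthogonality is imposed on the factors of all r terms;
   a term with zero coefficient can be rewritten with zero factors, so this
   does not restrict the set. *)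
Definition CON (R : realType) (d n r : nat) (Y : tensor R d n) : Prop :=
  exists (sigma : 'I_r -> R) (v : 'I_r -> 'I_d -> 'rV[R]_n),
    (forall k l : 'I_r, k != l -> completely_orthogonal (v k) (v l)) /\
    Y = \sum_(k < r) sigma k *: tprod (v k).

Definition optimal_CON_approx (R : realType) (d n r : nat)
    (T Y : tensor R d n) : Prop :=
  CON r Y /\ forall Z : tensor R d n, CON r Z -> tnorm (T - Y) <= tnorm (T - Z).

Definition orthonormal_family (R : realType) (m n : nat)
    (x : 'I_m -> 'rV[R]_n) : Prop :=
  forall i j : 'I_m, vdot (x i) (x j) = (i == j)%:R.

(* Main.v *)
Require Import Defs.
From mathcomp Require Import all_boot all_order all_fingroup all_algebra.
From mathcomp Require Import reals.
From mathcomp Require Import ring lra.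

Set Implicit Arguments.
Unset Strict Implicit.
Unset Printing Implicit Defensive.

Import Order.TTheory GRing.Theory Num.Theory.
Local Open Scope ring_scope.

(* For the squared norm, Y improves on the zero tensor by 2<T,Y> - <Y,Y>.
   Pairing a symmetric completely orthogonal Y with one of its terms, two of the
   factors being swapped, shows that the factors of each term are parallel, so
   Y = sum_k lam_k u_k (x) u_k (x) u_k with pairwise orthogonal u_k that are unit
   vectors or 0. Completing the square in lam_k, the gain of Y is at most
   sum_k (w_k1 w_k2 w_k3)^2, where w_k are the coordinates of u_k in the basis x.
   If some u_k is 0 this is at most 2/27. Otherwise w is an orthogonal matrix:
   the P_k = w_k1 w_k2 sum to 0, and w_k3^2 = 1 - w_k1^2 - w_k2^2 <= 1 - 2|P_k|,
   so the gain is at most sum_k (P_k^2 - 2|P_k|^3) <= 2/25. The nonsymmetric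
   tensor 1/6 (x1 (x) x2 (x) x3 + x2 (x) x3 (x) x1 + x3 (x) x1 (x) x2) gains
   1/12 > 2/25. *)

(** * Inner products of vectors and of elementary tensors *)

Section InnerProducts.
Variable R : realType.

Lemma vdotE n (u v : 'rV[R]_n) : vdot u v = (u *m v^T) 0 0.
Proof. by rewrite !mxE; apply: eq_bigr => i _; rewrite !mxE. Qed.

Lemma vdotC n (u v : 'rV[R]_n) : vdot u v = vdot v u.
Proof. by apply: eq_bigr => i _; rewrite mulrC. Qed.

Lemma vdotZl n (a : R) (u v : 'rV[R]_n) : vdot (a *: u) v = a * vdot u v.
Proof. by rewrite !vdotE -scalemxAl mxE. Qed.

Lemma vdotZr n (a : R) (u v : 'rV[R]_n) : vdot u (a *: v) = a * vdot u v.
Proof. by rewrite vdotC vdotZl vdotC. Qed.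

Lemma vdot0r n (u : 'rV[R]_n) : vdot u 0 = 0.
Proof. by rewrite vdotE trmx0 mulmx0 mxE. Qed.

Lemma vdot_delta n (u : 'rV[R]_n) i : vdot u (delta_mx 0 i) = u 0 i.
Proof.
rewrite /vdot (bigD1 i) //= mxE !eqxx mulr1 big1 ?addr0 // => j ji.
by rewrite mxE (negPf ji) andbF mulr0.
Qed.

Lemma vdot_ge0 n (u : 'rV[R]_n) : 0 <= vdot u u.
Proof. by apply: sumr_ge0 => i _; rewrite -expr2 sqr_ge0. Qed.

Lemma vdot_eq0 n (u : 'rV[R]_n) : (vdot u u == 0) = (u == 0).
Proof.
apply/eqP/eqP => [uu0|->]; last exact: vdot0r.
apply/rowP => i; rewrite mxE; apply/eqP; rewrite -sqrf_eq0 expr2; apply/eqP.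
by apply: (psumr_eq0P _ uu0) => // j _; rewrite -expr2 sqr_ge0.
Qed.

Lemma tdotC d n (S T : tensor R d n) : tdot S T = tdot T S.
Proof. by apply: eq_bigr => i _; rewrite mulrC. Qed.

Lemma tdotZl d n (a : R) (S T : tensor R d n) : tdot (a *: S) T = a * tdot S T.
Proof. by rewrite [RHS]mulr_sumr; apply: eq_bigr => i _; rewrite ffunE mulrA. Qed.

Lemma tdotZr d n (a : R) (S T : tensor R d n) : tdot S (a *: T) = a * tdot S T.
Proof. by rewrite tdotC tdotZl tdotC. Qed.

Lemma tdot_suml d n (I : finType) (F : I -> tensor R d n) (T : tensor R d n) :
  tdot (\sum_i F i) T = \sum_i tdot (F i) T.
Proof.
rewrite /tdot exchange_big; apply: eq_bigr => i _.
by rewrite sum_ffunE mulr_suml.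
Qed.

Lemma tdot_sumr d n (I : finType) (F : I -> tensor R d n) (T : tensor R d n) :
  tdot T (\sum_i F i) = \sum_i tdot T (F i).
Proof. by rewrite tdotC tdot_suml; apply: eq_bigr => i _; rewrite tdotC. Qed.

Lemma tdot_ge0 d n (T : tensor R d n) : 0 <= tdot T T.
Proof. by apply: sumr_ge0 => i _; rewrite -expr2 sqr_ge0. Qed.

Lemma tdot_sub d n (S T : tensor R d n) :
  tdot (S - T) (S - T) = tdot S S - (2 * tdot S T - tdot T T).
Proof.
rewrite /tdot [2 * _]mulr_sumr -sumrB -sumrB; apply: eq_bigr => i _.
rewrite !ffunE; ring.
Qed.

Lemma tdot_tprod d n (u v : 'I_d -> 'rV[R]_n) :
  tdot (tprod u) (tprod v) = \prod_j vdot (u j) (v j).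
Proof.
rewrite [RHS]bigA_distr_bigA; apply: eq_bigr => i _.
by rewrite !ffunE -big_split.
Qed.

(** Permuting the summation multi-index by [s] fixes the entries of [Y] and takes the permutation
    off the factors. *)
Lemma symmetric_tdot_tprod d n (Y : tensor R d n) (e : 'I_d -> 'rV[R]_n)
    (s : 'S_d) :
  symmetric_tensor Y -> tdot Y (tprod (fun j => e (s j))) = tdot Y (tprod e).
Proof.
move=> Ysym; have perm_ffunK : cancel
    (fun i : {ffun 'I_d -> 'I_n} => [ffun j => i (s j)])
    (fun i : {ffun 'I_d -> 'I_n} => [ffun j => i ((s^-1)%g j)]).
  by move=> i; apply/ffunP => j; rewrite !ffunE permKV.
rewrite /tdot (reindex_inj (can_inj perm_ffunK)) /=.
apply: eq_bigr => i _; rewrite Ysym !ffunE.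
congr (_ * _); rewrite [RHS](reindex_perm s).
by apply: eq_bigr => j _; rewrite ffunE.
Qed.

End InnerProducts.

(** * Symmetric completely orthogonal tensors as sums of orthogonal cubes *)

Section SymmetricCompletelyOrthogonal.
Variable R : realType.

(** As [p] and [q] vary, these identities make the factors [v k i] and [v k j] parallel. *)
Lemma CON_symmetric_slot_swap d n r (Y : tensor R d n) (sigma : 'I_r -> R)
    (v : 'I_r -> 'I_d -> 'rV[R]_n) (k : 'I_r) (i j m : 'I_d) (p q : 'rV[R]_n) :
  symmetric_tensor Y ->
  (forall k l, k != l -> completely_orthogonal (v k) (v l)) ->
  Y = \sum_l sigma l *: tprod (v l) ->
  i != j -> m != i -> m != j ->
  sigma k != 0 -> (forall l, v k l != 0) ->
  vdot (v k i) p * vdot (v k j) q = vdot (v k i) q * vdot (v k j) p.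
Proof.
move=> Ysym vorth YE ij mi mj sk0 vk0.
(* [v k] with slots i and j replaced; the untouched slot m keeps it orthogonal
   to every other term. *)
pose e p q l := if l == i then p else if l == j then q else v k l.
have tdotYe p' q' : tdot Y (tprod (e p' q')) =
    sigma k * (vdot (v k i) p' * (vdot (v k j) q'
      * \prod_(l | (l != i) && (l != j)) vdot (v k l) (v k l))).
  rewrite YE tdot_suml (bigD1 k) //= big1 ?addr0 => [|l lk].
    rewrite tdotZl tdot_tprod (bigD1 i) //= (bigD1 j) 1?eq_sym //=.
    rewrite /e !eqxx eq_sym (negPf ij); congr (_ * (_ * (_ * _))).
    by apply: eq_bigr => l /andP[/negPf-> /negPf->].
  rewrite tdotZl tdot_tprod (bigD1 m) //= /e (negPf mi) (negPf mj).
  by rewrite (vorth l k) // mul0r mulr0.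
have := symmetric_tdot_tprod (e p q) (tperm i j) Ysym.
have -> : tprod (fun l => e p q (tperm i j l)) = tprod (e q p).
  apply/ffunP => t; rewrite !ffunE; apply: eq_bigr => l _; rewrite /e.
  case: tpermP => [->|->|/eqP/negPf-> /eqP/negPf-> //]; rewrite !eqxx //.
    by rewrite eq_sym (negPf ij).
  by rewrite eq_sym (negPf ij).
(* Both sides share [sigma k] and the squared norms from the other slots, all nonzero. *)
rewrite !tdotYe => /(mulfI sk0); rewrite !mulrA => /mulIf E; apply/esym/E.
by apply/prodf_neq0 => l _; rewrite vdot_eq0.
Qed.

Lemma ord3_neq_third (j : 'I_3) : j != 0 -> exists2 m : 'I_3, m != 0 & m != j.
Proof. by case: j => [[|[|[|//]]]] //= h _; [exists 2%:R | exists 1]. Qed.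

(** Taking [u] as a multiple of the slot-0 factor lets orthogonality between terms pass to these
    vectors; a vanishing term gets [u = 0]. *)
Lemma CON_symmetric_term n r (Y : tensor R 3 n) (sigma : 'I_r -> R)
    (v : 'I_r -> 'I_3 -> 'rV[R]_n) (k : 'I_r) :
  symmetric_tensor Y ->
  (forall k l, k != l -> completely_orthogonal (v k) (v l)) ->
  Y = \sum_l sigma l *: tprod (v l) ->
  exists lam a : R, let u := a *: v k 0 in
    (u = 0 \/ vdot u u = 1) /\
    sigma k *: tprod (v k) = lam *: tprod (fun=> u).
Proof.
move=> Ysym vorth YE.
have [sk0|sk0] := eqVneq (sigma k) 0.
  by exists 0, 0; rewrite /= scale0r sk0 !scale0r; split; [left|].
have [/forallP vk0|] := boolP [forall l, v k l != 0]; last first.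
  rewrite negb_forall => /existsP[l /negbNE/eqP vkl0].
  exists 0, 0; rewrite /= !scale0r; split; first by left.
  apply/ffunP => i; rewrite !ffunE (bigD1 l) //= vkl0 mxE mul0r.
  exact: mulr0.
set w := v k 0; pose c j := vdot (v k j) w / vdot w w.
have ww0 : vdot w w != 0 by rewrite vdot_eq0; exact: vk0.
have vkE j : v k j = c j *: w.
  have [->|j0] := eqVneq j 0; first by rewrite /c divff // scale1r.
  have [m m0 mj] := ord3_neq_third j0.
  apply/rowP => l; rewrite mxE.
  (* Testing against a basis vector and [w] itself reads off coordinate [l] of [v k j]. *)
  have := CON_symmetric_slot_swap (delta_mx 0 l) w Ysym vorth YE _ m0 mj sk0 vk0.
  rewrite eq_sym => /(_ j0); rewrite !vdot_delta -/w => E.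
  by apply: (mulfI ww0); rewrite -E /c; field.
move: c vkE => c vkE.
pose N := Num.sqrt (vdot w w).
have NN : N ^+ 2 = vdot w w by rewrite sqr_sqrtr // vdot_ge0.
have N0 : N != 0 by apply: contra ww0 => /eqP N0; rewrite -NN N0 expr0n.
(* With [u = N^-1 *: w] of norm 1, each factor [v k j] is [c j * N] times [u]. *)
exists (sigma k * (\prod_j c j) * N ^+ 3), N^-1; split.
  by right; rewrite vdotZl vdotZr -/w -NN; field.
apply/ffunP => i; rewrite !ffunE.
have -> : \prod_j v k j 0 (i j) = \prod_j (c j * w 0 (i j)).
  by apply: eq_bigr => j _; rewrite vkE mxE.
have -> : \prod_j (N^-1 *: w) 0 (i j) = \prod_j (N^-1 * w 0 (i j)).
  by apply: eq_bigr => j _; rewrite mxE.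
rewrite !big_split prodr_const card_ord /= /GRing.scale /=.
by field.
Qed.

Lemma CON_symmetric_odeco n r (Y : tensor R 3 n) :
  CON r Y -> symmetric_tensor Y ->
  exists (lam : 'I_r -> R) (u : 'I_r -> 'rV[R]_n),
    [/\ forall k l, k != l -> vdot (u k) (u l) = 0,
        forall k, u k = 0 \/ vdot (u k) (u k) = 1
      & Y = \sum_k lam k *: tprod (fun=> u k)].
Proof.
move=> [sigma [v [vorth YE]]] Ysym.
have /fin_all_exists2 : forall k, exists2 la : R * R,
    let u := la.2 *: v k 0 in u = 0 \/ vdot u u = 1
    & sigma k *: tprod (v k) = la.1 *: tprod (fun=> la.2 *: v k 0).
  move=> k; have [lam [a [? ?]]] := CON_symmetric_term k Ysym vorth YE.
  by exists (lam, a).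
move=> [la u01 termE]; exists (fun k => (la k).1), (fun k => (la k).2 *: v k 0).
split=> // [k l kl|]; first by rewrite vdotZl vdotZr vorth // !mulr0.
by rewrite YE; apply: eq_bigr => k _; rewrite termE.
Qed.

End SymmetricCompletelyOrthogonal.

(** * Cubic inequalities and row products of an orthogonal 3 by 3 matrix *)

Section OrthogonalMatrixBound.
Variable R : realFieldType.
Implicit Types a b c p q r : R.

(** AM-GM: [2 * |a * b| <= a^2 + b^2 = 1 - c^2]. *)
Lemma sqr_prod3_le a b c : a ^+ 2 + b ^+ 2 + c ^+ 2 = 1 ->
  (a * b * c) ^+ 2 <= `|a * b| ^+ 2 - 2 * `|a * b| ^+ 3.
Proof.
move=> abc1.
have ab : 2 * `|a * b| <= a ^+ 2 + b ^+ 2.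
  rewrite normrM -(real_normK (num_real a)) -(real_normK (num_real b)).
  by have := sqr_ge0 (`|a| - `|b|); rewrite sqrrB; lra.
rewrite exprMn -[(a * b) ^+ 2](real_normK (num_real _)).
rewrite (_ : _ - _ = `|a * b| ^+ 2 * (1 - 2 * `|a * b|)); last by ring.
by apply: ler_wpM2l; [exact: sqr_ge0 | lra].
Qed.

Lemma sqr_sub_cube_le p : 0 <= p -> p ^+ 2 - 2 * p ^+ 3 <= 27^-1.
Proof.
move=> p0; rewrite -subr_ge0.
(* The maximum over [p >= 0] is attained at 1/3, hence the double root. *)
rewrite (_ : _ - _ = (p - 3^-1) ^+ 2 * (2 * p + 3^-1)); last by field.
by apply: mulr_ge0; [exact: sqr_ge0 | lra].
Qed.

Lemma sqr_sub_cube_sum_le p q : 0 <= p -> 0 <= q ->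
  ((p + q) ^+ 2 - 2 * (p + q) ^+ 3) + (p ^+ 2 - 2 * p ^+ 3)
  + (q ^+ 2 - 2 * q ^+ 3) <= 2 / 25.
Proof.
move=> p0 q0; set s := p + q; have s0 : 0 <= s by rewrite addr_ge0.
have pq0 : 0 <= p * q by rewrite mulr_ge0.
have -> : (s ^+ 2 - 2 * s ^+ 3) + (p ^+ 2 - 2 * p ^+ 3) + (q ^+ 2 - 2 * q ^+ 3)
    = 2 * (s ^+ 2 - 2 * s ^+ 3) + p * q * (6 * s - 2) by rewrite /s; ring.
(* The sign of [6 * s - 2] decides: if nonpositive, the [p * q] term is dropped and 2/27 bounds the
   rest; otherwise [p * q] is replaced by its maximum. *)
have [s3|s3] := lerP s 3^-1.
  have := sqr_sub_cube_le s0.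
  have : p * q * (6 * s - 2) <= 0 by rewrite mulr_ge0_le0 //; lra.
  lra.
have pq : p * q <= s ^+ 2 / 4.
  by have := sqr_ge0 (p - q); rewrite /s sqrrB sqrrD; lra.
have pqs : p * q * (6 * s - 2) <= s ^+ 2 / 4 * (6 * s - 2).
  by apply: ler_wpM2r => //; lra.
(* The bound has become [3/2 s^2 - 5/2 s^3], whose maximum 2/25 is at [s = 2/5]. *)
have : 0 <= (s - 2 / 5) ^+ 2 * (5 / 2 * s + 1 / 2).
  by apply: mulr_ge0; [exact: sqr_ge0 | lra].
have -> : (s - 2 / 5) ^+ 2 * (5 / 2 * s + 1 / 2) = 2 / 25
    - (2 * (s ^+ 2 - 2 * s ^+ 3) + s ^+ 2 / 4 * (6 * s - 2)) by field.
lra.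
Qed.

(** A zero sum makes the largest absolute value the sum of the other two. *)
Lemma sqr_sub_cube_norm_sum_le p q r : p + q + r = 0 ->
  (`|p| ^+ 2 - 2 * `|p| ^+ 3) + (`|q| ^+ 2 - 2 * `|q| ^+ 3)
  + (`|r| ^+ 2 - 2 * `|r| ^+ 3) <= 2 / 25.
Proof.
move=> pqr.
have H a b := sqr_sub_cube_sum_le (normr_ge0 a) (normr_ge0 b).
have : [\/ `|p| = `|q| + `|r|, `|q| = `|p| + `|r| | `|r| = `|p| + `|q|].
  case: (ger0P p) => hp; case: (ger0P q) => hq; case: (ger0P r) => hr;
  by [apply: Or31; lra | apply: Or32; lra | apply: Or33; lra].
case=> E.
- by have := H q r; rewrite -E; lra.
- by have := H p r; rewrite -E; lra.
- by have := H p q; rewrite -E; lra.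
Qed.

Lemma ord3E (k : 'I_3) : [\/ k = 0, k = 1 | k = 2%:R].
Proof.
by case: k => [[|[|[|//]]]] h; [apply: Or31|apply: Or32|apply: Or33]; apply/val_inj.
Qed.

Lemma big_ord3 (V : Type) (idx : V) (op : Monoid.law idx) (F : 'I_3 -> V) :
  \big[op/idx]_k F k = op (op (F 0) (F 1)) (F 2%:R).
Proof.
rewrite !big_ord_recr big_ord0 Monoid.mul1m /=.
by congr (op (op (F _) (F _)) (F _)); apply/val_inj.
Qed.

(* The analogous bound fails for unitary matrices: the sum of the squared moduli
   is 1/9 > 1/12 for the Fourier matrix. *)
Lemma orthogonal_rows_prod_sqr_le (W : 'M[R]_3) (n : 'I_3 -> R) :
  (forall k l, (W *m W^T) k l = (k == l)%:R * n k) ->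
  (forall k, n k = 0 \/ n k = 1) ->
  \sum_k (\prod_j W k j) ^+ 2 <= 2 / 25.
Proof.
move=> WW n01; pose P k : R := `|W k 0 * W k 1|.
have rowE k : W k 0 ^+ 2 + W k 1 ^+ 2 + W k 2%:R ^+ 2 = n k.
  have := WW k k; rewrite !mxE eqxx mul1r => <-.
  by rewrite big_ord3 !mxE !expr2.
have row_le k : n k = 1 -> (\prod_j W k j) ^+ 2 <= P k ^+ 2 - 2 * P k ^+ 3.
  by move=> nk; rewrite big_ord3; apply: sqr_prod3_le; rewrite rowE.
have row0 k : n k = 0 -> (\prod_j W k j) ^+ 2 = 0.
  move=> nk; have /eqP := rowE k; rewrite nk.
  rewrite !paddr_eq0 ?addr_ge0 ?sqr_ge0 // !sqrf_eq0 => /andP[/andP[/eqP W0 _] _].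
  by rewrite big_ord3 W0 /= !mul0r expr0n.
have row_le27 k : (\prod_j W k j) ^+ 2 <= 27^-1.
  case: (n01 k) => [/row0->|/row_le/le_trans]; first by rewrite invr_ge0.
  by apply; apply: sqr_sub_cube_le; exact: normr_ge0.
rewrite big_ord3 /=.
have := row_le27 0; have := row_le27 1; have := row_le27 2%:R.
(* A zero row leaves two terms of at most 1/27 each, and 2/27 < 2/25. *)
case: (n01 0) => [/row0|] n0; first lra.
case: (n01 1) => [/row0|] n1; first lra.
case: (n01 2%:R) => [/row0|] n2; first lra.
move=> _ _ _.
have W1 : W *m W^T = 1%:M.
  apply/matrixP => k l; rewrite WW mxE.
  by case: (ord3E k) => ->; rewrite ?n0 ?n1 ?n2 mulr1.
(* The columns are orthonormal too; the first two give [\sum_k W k 0 * W k 1 = 0]. *)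
have /matrixP/(_ 0 1) := mulmx1C W1.
rewrite !mxE big_ord3 !mxE /= => colE.
have := sqr_sub_cube_norm_sum_le colE.
have := row_le _ n0; have := row_le _ n1; have := row_le _ n2.
rewrite /P; lra.
Qed.

End OrthogonalMatrixBound.

(** * Gains over the zero tensor: symmetric candidates against a cyclic one *)

Section Symmetrization.
Variables (R : realType) (x : 'I_3 -> 'rV[R]_3).
Hypothesis hx : orthonormal_family x.
Let T : tensor R 3 3 := 6%:R^-1 *: \sum_(s : 'S_3) tprod (fun j => x (s j)).

Lemma tdot_sym_cube u : tdot T (tprod (fun=> u)) = \prod_j vdot (x j) u.
Proof.
have cubeE (s : 'S_3) :
    tdot (tprod (fun j => x (s j))) (tprod (fun=> u)) = \prod_j vdot (x j) u.
  by rewrite tdot_tprod [RHS](reindex_perm s).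
rewrite tdotZl tdot_suml (eq_bigr _ (fun s _ => cubeE s)).
by rewrite sumr_const card_Sn (_ : 3`! = 6)%N //; field.
Qed.

Lemma tdot_sym_perm (t : 'S_3) : tdot T (tprod (fun j => x (t j))) = 6%:R^-1.
Proof.
rewrite tdotZl tdot_suml (bigD1 t) //= big1 => [|s st].
  by rewrite tdot_tprod big1 ?addr0 ?mulr1 // => j _; rewrite hx eqxx.
have /existsP[j sj] : [exists j, s j != t j].
  apply: contraR st; rewrite negb_exists => /forallP E.
  by apply/eqP/permP => j; apply/eqP/negbNE/E.
by rewrite tdot_tprod (bigD1 j) //= hx (negPf sj) mul0r.
Qed.

Lemma symmetric_CON_gain Y : CON 3 Y -> symmetric_tensor Y ->
  2 * tdot T Y - tdot Y Y <= 2 / 25.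
Proof.
move=> YCON Ysym.
have [lam [u [uorth u01 YE]]] := CON_symmetric_odeco YCON Ysym.
pose n k := vdot (u k) (u k).
pose W := \matrix_(k, j) vdot (x j) (u k).
have gE k : tdot T (tprod (fun=> u k)) = \prod_j W k j.
  by rewrite tdot_sym_cube; apply: eq_bigr => j _; rewrite mxE.
have n01 k : n k = 0 \/ n k = 1.
  by case: (u01 k) => E; [left; rewrite /n E vdot0r | right].
have WE : W *m W^T = \matrix_(k, l) vdot (u k) (u l).
  pose X := \matrix_(j < 3) x j; pose U := \matrix_(k < 3) u k.
  have mulTE (A B : 'M[R]_3) : A *m B^T = \matrix_(k, l) vdot (row k A) (row l B).
    apply/matrixP => k l; rewrite !mxE.
    by apply: eq_bigr => i _; rewrite !mxE.
  have X1 : X *m X^T = 1%:M.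
    by rewrite mulTE; apply/matrixP => i j; rewrite !mxE !rowK hx.
  have -> : W = U *m X^T.
    by rewrite mulTE; apply/matrixP => i j; rewrite !mxE !rowK vdotC.
  (* Since [X] is orthogonal, [W *m W^T] is the Gram matrix [U *m U^T]. *)
  rewrite trmx_mul trmxK mulmxA -[U *m _ *m X]mulmxA (mulmx1C X1) mulmx1 mulTE.
  by apply/matrixP => i j; rewrite !mxE !rowK.
have tdotYY : tdot Y Y = \sum_k lam k ^+ 2 * n k.
  rewrite YE tdot_suml; apply: eq_bigr => k _; rewrite tdot_sumr (bigD1 k) //=.
  rewrite big1 ?addr0 => [|l lk].
    rewrite tdotZl tdotZr tdot_tprod prodr_const card_ord -/(n k).
    (* The cube of [n k] is [n k], its value being 0 or 1. *)
    by case: (n01 k) => ->; rewrite ?expr0n ?expr1n /= ?mulr0 ?mulr1 ?expr2.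
  rewrite tdotZl tdotZr tdot_tprod prodr_const card_ord uorth 1?eq_sym //.
  by rewrite expr0n !mulr0.
have tdotTY : tdot T Y = \sum_k lam k * \prod_j W k j.
  by rewrite YE tdot_sumr; apply: eq_bigr => k _; rewrite tdotZr gE.
have WWT k l : (W *m W^T) k l = (k == l)%:R * n k.
  rewrite WE mxE; case: eqVneq => [->|kl]; first by rewrite mul1r.
  by rewrite uorth // mul0r.
apply: le_trans (orthogonal_rows_prod_sqr_le WWT n01).
rewrite tdotTY tdotYY mulr_sumr -sumrB; apply: ler_sum => k _.
case: (u01 k) => nk.
  have -> : n k = 0 by rewrite /n nk vdot0r.
  rewrite -gE tdot_sym_cube nk big_ord3 /= !vdot0r; lra.
(* Completing the square: [2 * lam * g - lam^2 <= g^2]. *)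
by have := sqr_ge0 (lam k - \prod_j W k j); rewrite sqrrB /n nk; lra.
Qed.

(** The shift of [j] to [k + j] modulo 3; distinct shifts disagree at every [j]. *)
Let cyclic (k : 'I_3) : 'S_3 := perm (addrI k).

(** Three orthonormal terms, each with coefficient 1/6 and pairing 1/6 with [T], gain
    [2 * 3/36 - 3/36]. *)
Lemma cyclic_CON_gain : exists2 Z : tensor R 3 3, CON 3 Z &
  2 * tdot T Z - tdot Z Z = 12^-1.
Proof.
have cyc_orth k l : k != l ->
    completely_orthogonal (fun j => x (cyclic k j)) (fun j => x (cyclic l j)).
  by move=> kl j; rewrite hx !permE (inj_eq (addIr j)) (negPf kl).
exists (\sum_k 6%:R^-1 *: tprod (fun j => x (cyclic k j))).
  by exists (fun=> 6%:R^-1), (fun k j => x (cyclic k j)).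
have -> : tdot T (\sum_k 6%:R^-1 *: tprod (fun j => x (cyclic k j))) = 12^-1.
  rewrite tdot_sumr (eq_bigr (fun=> 6%:R^-1 * 6%:R^-1)) => [|k _].
    by rewrite sumr_const card_ord; field.
  by rewrite tdotZr tdot_sym_perm.
rewrite tdot_suml (eq_bigr (fun=> 36^-1)) => [|k _].
  by rewrite sumr_const card_ord; field.
rewrite tdot_sumr (bigD1 k) //= big1 ?addr0 => [|l lk].
  rewrite tdotZl tdotZr tdot_tprod big1 => [|j _]; first by field.
  by rewrite hx eqxx.
by rewrite tdotZl tdotZr tdot_tprod big_ord3 /= cyc_orth 1?eq_sym // !mul0r !mulr0.
Qed.

End Symmetrization.

Theorem theorem4p7 (R : realType) (x : 'I_3 -> 'rV[R]_3)
    (hx : orthonormal_family x) (T : tensor R 3 3)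
    (hT : T = 6%:R^-1 *: \sum_(s : 'S_3) tprod (fun j : 'I_3 => x (s j))) :
  ~ exists Y : tensor R 3 3, optimal_CON_approx 3 T Y /\ symmetric_tensor Y.
Proof.
case=> Y [[YCON Yopt] Ysym].
have [Z ZCON Zgain] := cyclic_CON_gain hx.
have Ygain := symmetric_CON_gain hx YCON Ysym.
have := Yopt Z ZCON.
(* A squared distance is [tdot T T] minus the gain, so optimality of [Y] would force 1/12 <=
   2/25. *)
rewrite /tnorm ler_sqrt ?tdot_ge0 // !tdot_sub hT; lra.
Qed.
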